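(* Work in the path algebra $\Bbbk\overline{\Gamma}_n$. For $n\geq1$, $$(a_1,b_1,\dots,b_{n-1},a_n)=\sum_{\ell=3}^{n+1}\Big[(a_1,b_1,\dots,a_{\ell-2},b_{\ell-2})\,a_{\ell-1}\Big]+a_1,$$ and for $n\ge2$, $$(a_1,b_1,\dots,a_n,b_n)=(a_1,b_1,\dots,a_{n-1},b_{n-1})(a_n,b_n)+\sum_{\ell=3}^{n}\Big[(a_1,b_1,\dots,a_{\ell-2},b_{\ell-2})\,a_{\ell-1}b_n\Big]+a_1b_n.$$
   Context: $\Bbbk$ is a field of characteristic zero. $\Bbbk\overline{\Gamma}_n$ is the path algebra generated by orthogonal idempotents $e_1,e_2$ with $e_1+e_2=1$ and by $a_i=e_2a_ie_1$, $b_i=e_1b_ie_2$ ($1\le i\le n$). Euler continuants, for sequences alternating between letters from $\{a_i\}$ and from $\{b_i\}$: $(a_i)=a_i$, $(b_i)=b_i$, $(a_i,b_j)=e_2+a_ib_j$, $(b_i,a_j)=e_1+b_ia_j$, and $(y_1,\dots,y_k)=(y_1,\dots,y_{k-1})y_k+(y_1,\dots,y_{k-2})$ for $k\ge3$. Empty sums are zero. *)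

(* Defs.v *)
From HB Require Import structures.
From mathcomp Require Import all_boot all_algebra.
From mathcomp Require Import finmap monalg.

Set Implicit Arguments.
Unset Strict Implicit.
Unset Printing Implicit Defensive.

Import GRing.Theory.
Local Open Scope ring_scope.

Record quiver := Quiver {
  vertex : finType;
  arrow : finType;
  src : arrow -> vertex;
  tgt : arrow -> vertex }.

(* Paths compose like functions: [:: y_1; ...; y_k] is a path from src y_k to
   tgt y_1 when src y_i = tgt y_(i.+1) for all i < k. It is stored together with
   its end vertex, so that (v, [::]) is the trivial path at v. *)
Section Paths.
Variable Q : quiver.

Fixpoint is_qpath (v : vertex Q) (s : seq (arrow Q)) : bool :=
  if s is y :: s' then (tgt y == v) && is_qpath (src y) s' else true.

Definition qpath := {p : vertex Q * seq (arrow Q) | is_qpath p.1 p.2}.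

Definition qend (p : qpath) : vertex Q := (val p).1.

Fixpoint start_from (v : vertex Q) (s : seq (arrow Q)) : vertex Q :=
  if s is y :: s' then start_from (src y) s' else v.

Definition qstart (p : qpath) : vertex Q := start_from (val p).1 (val p).2.

Definition qtrivial (v : vertex Q) : qpath :=
  exist (fun p => is_qpath p.1 p.2) (v, [::]) isT.

Lemma qarrow_subproof (y : arrow Q) : is_qpath (tgt y) [:: y].
Proof. by rewrite /= eqxx. Qed.

Definition qarrow (y : arrow Q) : qpath :=
  exist (fun p => is_qpath p.1 p.2) (tgt y, [:: y]) (qarrow_subproof y).

Lemma is_qpath_cat v s t :
  is_qpath v (s ++ t) = is_qpath v s && is_qpath (start_from v s) t.
Proof. by elim: s v => //= y s IHs v; rewrite IHs andbA. Qed.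

Lemma start_from_cat v s t :
  start_from v (s ++ t) = start_from (start_from v s) t.
Proof. by elim: s v => //= y s IHs v. Qed.

(* None when the two paths are not composable. *)
Definition qcomp (p q : qpath) : option qpath :=
  if qstart p == qend q then (insub ((val p).1, (val p).2 ++ (val q).2) : option qpath)
  else None.

Lemma qcompP p q : qstart p = qend q ->
  exists r, [/\ qcomp p q = Some r, (val r).1 = (val p).1
              & (val r).2 = (val p).2 ++ (val q).2].
Proof.
move=> e; rewrite /qcomp e eqxx; case: insubP => [r _ vr | /negP[]].
  by exists r; rewrite vr.
by rewrite /= is_qpath_cat (valP p) /= -/(qstart p) e (valP q).
Qed.

Lemma qcompN p q : qstart p != qend q -> qcomp p q = None.
Proof. by rewrite /qcomp => /negPf ->. Qed.

Lemma qcompA p q r :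
  obind (qcomp p) (qcomp q r) = obind (fun s => qcomp s r) (qcomp p q).
Proof.
have start_comp (s t u : qpath) : (val u).1 = (val s).1 ->
    (val u).2 = (val s).2 ++ (val t).2 -> qstart s = qend t ->
    qstart u = qstart t.
  by move=> e1 e2; rewrite /qstart e1 e2 start_from_cat => ->.
case: (eqVneq (qstart p) (qend q)) => pq; last first.
  rewrite [qcomp p q]qcompN //=; case: (eqVneq (qstart q) (qend r)) => qr.
    by have [s [-> e1 _]] := qcompP qr; rewrite /= qcompN // /qend e1.
  by rewrite qcompN.
have [s [-> s1 s2]] := qcompP pq; have ss := start_comp _ _ _ s1 s2 pq.
case: (eqVneq (qstart q) (qend r)) => qr /=; last first.
  by rewrite !qcompN // ss.
have [t [-> t1 t2]] := qcompP qr.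
have pt : qstart p = qend t by rewrite pq /qend t1.
have sr : qstart s = qend r by rewrite ss.
have [u [/= -> u1 u2]] := qcompP pt; have [w [-> w1 w2]] := qcompP sr.
congr Some; apply: val_inj; rewrite [LHS]surjective_pairing.
rewrite [RHS]surjective_pairing.
by rewrite u1 u2 w1 w2 s1 s2 t2 catA.
Qed.

Lemma qcomp1p v p : qcomp (qtrivial v) p = if v == qend p then Some p else None.
Proof.
case: eqVneq => [e | ne]; last by rewrite qcompN.
have [r [-> r1 r2]] := @qcompP (qtrivial v) p e.
congr Some; apply: val_inj; rewrite [LHS]surjective_pairing r1 r2 /= e.
by rewrite [RHS]surjective_pairing.
Qed.

Lemma qcompp1 v p :
  qcomp p (qtrivial v) = if qstart p == v then Some p else None.
Proof.
case: eqVneq => [e | ne]; last by rewrite qcompN.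
have [r [-> r1 r2]] := @qcompP p (qtrivial v) e.
congr Some; apply: val_inj; rewrite [LHS]surjective_pairing r1 r2 /= cats0.
by rewrite -surjective_pairing.
Qed.

End Paths.

Definition path_algebra (R : comNzRingType) (Q : quiver) : Type :=
  {malg R[qpath Q]}.

HB.instance Definition _ (R : comNzRingType) (Q : quiver) :=
  GRing.Lmodule.on (path_algebra R Q).

(* pbasis and pmul are locked only to keep unification from unfolding them. *)
HB.lock Definition pbasis (R : comNzRingType) (Q : quiver) (p : qpath Q) :
  path_algebra R Q := << p >>.

(* The linear map from the path algebra to V with values f on the basis of
   paths. *)
Definition plift (R : comNzRingType) (Q : quiver) (V : lmodType R)
    (f : qpath Q -> V) (x : path_algebra R Q) : V :=
  \sum_(p <- msupp x) x@_p *: f p.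

Definition pmul_basis (R : comNzRingType) (Q : quiver) (p q : qpath Q) :
  path_algebra R Q := oapp (@pbasis R Q) 0 (qcomp p q).

HB.lock Definition pmul (R : comNzRingType) (Q : quiver)
    (x y : path_algebra R Q) : path_algebra R Q :=
  plift (fun p => plift (@pmul_basis R Q p) y) x.

Section PathAlgebra.
Variables (R : comNzRingType) (Q : quiver).
Local Notation P := (qpath Q).
Local Notation A := (path_algebra R Q).
Local Notation pbasis := (@pbasis R Q).
Local Notation pmul := (@pmul R Q).
Local Notation pmul_basis := (@pmul_basis R Q).

Definition pone : A := \sum_(v : vertex Q) pbasis (qtrivial v).

Section Lift.
Variable V : lmodType R.
Implicit Types (f : P -> V) (x y : A).

Lemma pliftEw f x (d : {fset P}) : (msupp x `<=` d)%fset ->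
  plift f x = \sum_(p <- d) x@_p *: f p.
Proof.
move=> le; rewrite /plift (big_fset_incl _ le) // => p _ /mcoeff_outdom ->.
by rewrite scale0r.
Qed.

Lemma plift_linear f : linear (plift f).
Proof.
move=> c x y; pose d := (msupp x `|` msupp y `|` msupp (c *: x + y))%fset.
have dx : (msupp x `<=` d)%fset by rewrite /d -fsetUA fsubsetUl.
have dy : (msupp y `<=` d)%fset by rewrite /d fsetUAC fsubsetUr.
have dz : (msupp (c *: x + y : A) `<=` d)%fset by rewrite fsubsetUr.
rewrite (pliftEw f dx) (pliftEw f dy) (pliftEw f dz).
rewrite scaler_sumr -big_split; apply: eq_bigr => p _ /=.
by rewrite mcoeffD mcoeffZ scalerDl scalerA.
Qed.

HB.instance Definition _ f :=
  GRing.isLinear.Build R A V *:%R (plift f) (plift_linear f).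

Lemma plift_basis f p : plift f (pbasis p) = f p.
Proof. by rewrite pbasis.unlock /plift msuppU oner_eq0 big_seq_fset1 mcoeffUU scale1r. Qed.

Lemma basisE x : x = \sum_(p <- msupp x) x@_p *: pbasis p.
Proof.
rewrite {1}[x]monalgE; apply: eq_bigr => p _; apply/malgP => q.
by rewrite mcoeffU (mcoeffZ x@_p (pbasis p)) pbasis.unlock mcoeffU mulr_natr.
Qed.

Lemma lin_ext (g h : {linear A -> V}) :
  (forall p, g (pbasis p) = h (pbasis p)) -> g =1 h.
Proof.
move=> gh x; rewrite [x]basisE !linear_sum; apply: eq_bigr => p _.
by rewrite !linearZ gh.
Qed.

Lemma plift_fun c f1 f2 x :
  plift (fun p => c *: f1 p + f2 p) x = c *: plift f1 x + plift f2 x.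
Proof.
rewrite /plift scaler_sumr -big_split; apply: eq_bigr => p _ /=.
by rewrite scalerDr !scalerA mulrC.
Qed.

Lemma eq_plift f1 f2 x : f1 =1 f2 -> plift f1 x = plift f2 x.
Proof. by move=> e; apply: eq_bigr => p _; rewrite e. Qed.

End Lift.

Definition pmulr (y x : A) : A := pmul x y.

Lemma pmul_linl y : linear (pmulr y).
Proof. by move=> c x1 x2; rewrite /pmulr pmul.unlock linearP. Qed.

Lemma pmul_linr x : linear (pmul x).
Proof.
move=> c y1 y2; rewrite pmul.unlock; apply: etrans (plift_fun _ _ _ _).
by apply: eq_plift => p; apply: linearP.
Qed.

HB.instance Definition _ y :=
  GRing.isLinear.Build R A A *:%R (pmulr y) (pmul_linl y).
HB.instance Definition _ x :=
  GRing.isLinear.Build R A A *:%R (pmul x) (pmul_linr x).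

Lemma pmul0x y : pmul 0 y = 0. Proof. exact: (linear0 (pmulr y)). Qed.

Lemma pmulx0 x : pmul x 0 = 0. Proof. exact: (linear0 (pmul x)). Qed.

Lemma pmulbb p q : pmul (pbasis p) (pbasis q) = pmul_basis p q.
Proof. by rewrite pmul.unlock !plift_basis. Qed.

Lemma pmulA : associative pmul.
Proof.
move=> x y z.
apply: (lin_ext (g := pmulr (pmul y z)) (h := pmulr z \o pmulr y)) => p /=.
apply: (lin_ext (g := pmul (pbasis p) \o pmulr z)
                (h := pmulr z \o pmul (pbasis p))) => q /=.
apply: (lin_ext (g := pmul (pbasis p) \o pmul (pbasis q))
                (h := pmul (pmul (pbasis p) (pbasis q)))) => r /=.
rewrite /pmulr (pmulbb q r) (pmulbb p q) /pmul_basis; have := qcompA p q r.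
case: (qcomp q r) (qcomp p q) => [s|] [t|] /=.
- by rewrite (pmulbb p s) (pmulbb t r) /pmul_basis => ->.
- by rewrite (pmulbb p s) pmul0x /pmul_basis => ->.
- by rewrite (pmulbb t r) pmulx0 /pmul_basis => <-.
- by rewrite pmul0x pmulx0.
Qed.

Lemma pmul1x : left_id pone pmul.
Proof.
move=> x; apply: (lin_ext (g := pmul pone) (h := idfun)) => p /=.
rewrite -/(pmulr (pbasis p) pone) /pone linear_sum /= (bigD1 (qend p)) //=.
rewrite big1 => [|v ne]; rewrite /pmulr pmulbb /pmul_basis qcomp1p.
  by rewrite eqxx addr0.
by rewrite (negPf ne).
Qed.

Lemma pmulx1 : right_id pone pmul.
Proof.
move=> x; apply: (lin_ext (g := pmulr pone) (h := idfun)) => p /=.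
rewrite /pmulr /pone linear_sum (bigD1 (qstart p)) //=.
rewrite big1 => [|v ne]; rewrite pmulbb /pmul_basis qcompp1.
  by rewrite eqxx addr0.
by rewrite eq_sym (negPf ne).
Qed.

Lemma pmulDl : left_distributive pmul +%R.
Proof. by move=> x y z; apply: (linearD (pmulr z)). Qed.

Lemma pmulDr : right_distributive pmul +%R.
Proof. by move=> x y z; apply: linearD. Qed.

HB.instance Definition _ := GRing.Zmodule_isPzRing.Build A
  pmulA pmul1x pmulx1 pmulDl pmulDr.

Lemma pscaleAl (c : R) (x y : A) : c *: (x * y) = (c *: x) * y.
Proof. exact: esym (linearZ_LR (pmulr y) c x). Qed.

Lemma pscaleAr (c : R) (x y : A) : c *: (x * y) = x * (c *: y).
Proof. exact: esym (linearZ_LR (pmul x) c y). Qed.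

Definition idem (v : vertex Q) : A := pbasis (qtrivial v).
Definition gen (y : arrow Q) : A := pbasis (qarrow y).

End PathAlgebra.

(* The quiver with vertices 1 = false, 2 = true and arrows
   a_i = inl i : 1 -> 2, b_i = inr i : 2 -> 1. *)
Definition Gamma (n : nat) : quiver := Quiver
  (fun y : 'I_n + 'I_n => if y is inl _ then false else true)
  (fun y : 'I_n + 'I_n => if y is inl _ then true else false).

Definition kGamma (R : comNzRingType) (n : nat) : Type :=
  path_algebra R (Gamma n).

HB.instance Definition _ (R : comNzRingType) (n : nat) :=
  GRing.Lmodule.on (kGamma R n).
HB.instance Definition _ (R : comNzRingType) (n : nat) :=
  GRing.PzRing.on (kGamma R n).

(* Indices of letters run from 1 as in a_1, ..., a_n. *)
Inductive letter := La of nat | Lb of nat.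

Section Gamma.
Variables (R : comNzRingType) (n : nat).
Local Notation A := (kGamma R n).

Lemma kGamma_1neq0 : 1 != 0 :> A.
Proof.
apply/eqP => /(congr1 (fun x : A => x@_(qtrivial (false : vertex (Gamma n))))).
apply/eqP; rewrite [X in X@_ _ != _](_ : _ = pone R (Gamma n)) // /pone.
rewrite raddf_sum (bigD1 false) //= big1 => [|v /negPf ne].
  by rewrite pbasis.unlock mcoeffU eqxx addr0 mcoeff0 oner_eq0.
rewrite pbasis.unlock mcoeffU; case: eqP => // -[ev].
by rewrite ev in ne.
Qed.

HB.instance Definition _ := GRing.PzSemiRing_isNonZero.Build A kGamma_1neq0.
HB.instance Definition _ :=
  GRing.Lmodule_isLalgebra.Build R A (@pscaleAl R (Gamma n)).
HB.instance Definition _ :=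
  GRing.Lalgebra_isAlgebra.Build R A (@pscaleAr R (Gamma n)).

Definition e1 : A := idem R (false : vertex (Gamma n)).
Definition e2 : A := idem R (true : vertex (Gamma n)).

Definition index1 (i : nat) : option 'I_n :=
  if i is j.+1 then insub j else None.

(* a_ i and b_ i are the generators for 1 <= i <= n, and 0 for other i. *)
Definition a_ (i : nat) : A :=
  oapp (fun j => gen R (inl j : arrow (Gamma n))) 0 (index1 i).
Definition b_ (i : nat) : A :=
  oapp (fun j => gen R (inr j : arrow (Gamma n))) 0 (index1 i).

Definition letter_val (y : letter) : A :=
  match y with La i => a_ i | Lb i => b_ i end.

(* Continuant of a reversed sequence. Only nonempty alternating sequences are
   meaningful; the value 0 on [::] is arbitrary and is never used by the
   recursion. *)
Fixpoint rev_continuant (s : seq letter) : A :=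
  match s with
  | [::] => 0
  | [:: y] => letter_val y
  | [:: z; y] =>
      (if y is La _ then e2 else e1) + letter_val y * letter_val z
  | z :: ((_ :: s2) as s1) =>
      rev_continuant s1 * letter_val z + rev_continuant s2
  end.

Definition continuant (s : seq letter) : A := rev_continuant (rev s).

Lemma continuant1 y : continuant [:: y] = letter_val y.
Proof. by []. Qed.

Lemma continuant_ab i j : continuant [:: La i; Lb j] = e2 + a_ i * b_ j.
Proof. by []. Qed.

Lemma continuant_ba i j : continuant [:: Lb i; La j] = e1 + b_ i * a_ j.
Proof. by []. Qed.

Lemma continuantS s x y z :
  continuant (rcons (rcons (rcons s x) y) z) =
  continuant (rcons (rcons s x) y) * letter_val z + continuant (rcons s x).
Proof. by rewrite /continuant !rev_rcons. Qed.

Lemma e1De2 : e1 + e2 = 1.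
Proof.
by rewrite [1](_ : _ = pone R (Gamma n)) // /pone big_bool /= addrC.
Qed.

Lemma e1e1 : e1 * e1 = e1.
Proof. by rewrite [LHS]pmulbb /pmul_basis qcomp1p. Qed.

Lemma e2e2 : e2 * e2 = e2.
Proof. by rewrite [LHS]pmulbb /pmul_basis qcomp1p. Qed.

Lemma e1e2 : e1 * e2 = 0.
Proof. by rewrite [LHS]pmulbb /pmul_basis qcomp1p. Qed.

Lemma e2e1 : e2 * e1 = 0.
Proof. by rewrite [LHS]pmulbb /pmul_basis qcomp1p. Qed.

Lemma a_E i : a_ i = e2 * a_ i * e1.
Proof.
rewrite /a_; case: (index1 i) => [j|] /=; last by rewrite mulr0 mul0r.
rewrite [e2 * _](_ : _ = gen R (inl j : arrow (Gamma n))).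
  by rewrite [RHS]pmulbb /pmul_basis qcompp1.
by rewrite [LHS]pmulbb /pmul_basis qcomp1p.
Qed.

Lemma b_E i : b_ i = e1 * b_ i * e2.
Proof.
rewrite /b_; case: (index1 i) => [j|] /=; last by rewrite mulr0 mul0r.
rewrite [e1 * _](_ : _ = gen R (inr j : arrow (Gamma n))).
  by rewrite [RHS]pmulbb /pmul_basis qcompp1.
by rewrite [LHS]pmulbb /pmul_basis qcomp1p.
Qed.

End Gamma.

(* (a_1, b_1, ..., a_m, b_m) *)
Definition word_ab (m : nat) : seq letter :=
  flatten [seq [:: La i; Lb i] | i <- iota 1 m].

(* (a_1, b_1, ..., b_(m-1), a_m), for m >= 1 *)
Definition word_aba (m : nat) : seq letter := rcons (word_ab m.-1) (La m).

(* Main.v *)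
Require Import Defs.
From mathcomp Require Import all_boot all_algebra.

Import GRing.Theory.
Local Open Scope ring_scope.

(** Unrolling the continuant recursion along the words ending in $a_m$ telescopes down to $(a_1) =
    a_1$, which gives the first identity ([continuant_aba_sum]). For the second, write $C =
    (a_1,\dots,b_{n-1})$: the recursion gives $(C a_n + (a_1,\dots,a_{n-1})) b_n + C$. Since $C e_2
    = C$ ([continuant_ab_e2]), the two terms in $C$ combine to $C(e_2 + a_n b_n) = C\,(a_n,b_n)$,
    and the first identity expands the rest. *)

Lemma word_abS m :
  word_ab m.+1 = rcons (rcons (word_ab m) (La m.+1)) (Lb m.+1).
Proof.
by rewrite /word_ab -[in LHS](addn1 m) iotaD map_cat flatten_cat -!cats1 -catA.
Qed.

Lemma word_abaE m : word_aba m.+1 = rcons (word_ab m) (La m.+1).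
Proof. by []. Qed.

Section Continuants.
Variables (R : comNzRingType) (n : nat).

Lemma continuant_abaS m :
  continuant R n (word_aba m.+2) =
  continuant R n (word_ab m.+1) * a_ R n m.+2 + continuant R n (word_aba m.+1).
Proof. by rewrite !word_abaE word_abS continuantS. Qed.

Lemma continuant_abS m :
  continuant R n (word_ab m.+2) =
  continuant R n (word_aba m.+2) * b_ R n m.+2 + continuant R n (word_ab m.+1).
Proof. by rewrite !word_abS word_abaE word_abS continuantS. Qed.

Lemma b_e2 i : b_ R n i * e2 R n = b_ R n i.
Proof. by rewrite b_E -!mulrA e2e2. Qed.

(** Every term ends in $e_2$ or some $b_j$. This lets the lone $C$ be absorbed into $C\,(a_n,b_n)$,
    whose constant term is $e_2$ and not $1$. *)
Lemma continuant_ab_e2 m :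
  continuant R n (word_ab m.+1) * e2 R n = continuant R n (word_ab m.+1).
Proof.
elim: m => [|m IHm]; first by rewrite continuant_ab mulrDl e2e2 -mulrA b_e2.
by rewrite continuant_abS mulrDl IHm -mulrA b_e2.
Qed.

Lemma continuant_aba_sum m :
  continuant R n (word_aba m.+1) =
  \sum_(3 <= l < m.+3) continuant R n (word_ab (l - 2)) * a_ R n (l - 1)
  + a_ R n 1.
Proof.
elim: m => [|m IHm]; first by rewrite big_geq // add0r continuant1.
(* The summand split off, [l = m.+3], is the product term of the recursion. *)
by rewrite continuant_abaS IHm [in RHS]big_nat_recr //= subn1 subn2 addrA (addrC (_ * _)).
Qed.

End Continuants.

Theorem lemma3p2 (K : fieldType) (charK0 : [pchar K] =i pred0) (n : nat) :
  ((1 <= n)%N ->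
    continuant K n (word_aba n) =
      (\sum_(3 <= l < n.+2) continuant K n (word_ab (l - 2)) * a_ K n (l - 1))
      + a_ K n 1)
  /\
  ((2 <= n)%N ->
    continuant K n (word_ab n) =
      continuant K n (word_ab n.-1) * continuant K n [:: La n; Lb n]
      + (\sum_(3 <= l < n.+1)
           continuant K n (word_ab (l - 2)) * a_ K n (l - 1) * b_ K n n)
      + a_ K n 1 * b_ K n n).
Proof.
split; first by case: n => // n _; apply: continuant_aba_sum.
case: n => [|[|m]] // _.
(* With [n = m.+2], the sum formula is applied only to [word_aba m.+1], so the sum stops at
   [l = n]. *)
rewrite continuant_abS continuant_abaS continuant_aba_sum continuant_ab /=.
by rewrite mulrDr continuant_ab_e2 !mulrDl mulr_suml mulrA addrC !addrA.
Qed.
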